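(* Let $\mathcal{G}$ be a $d$-uniform hypergraph, and let $P$ be a perfect coloring of $\mathcal{G}$ into $k$ colors with parameter matrix $\mathbb{S}$. Let $N=P^TP$. Then the $d$-dimensional matrix $\mathbb{H}=N\circ\mathbb{S}$, with entries $$h_\beta=\sum_{j=1}^k n_{\beta_1,j}\,s_{j,\beta_2,\dots,\beta_d},$$ is symmetric.
   Context: A $d$-uniform hypergraph on vertex set $[n]$ has $d$-element hyperedges. Its adjacency matrix $\mathbb{A}$ is the $d$-dimensional array with $a_{(x_1,\dots,x_d)}=1/(d-1)!$ if $\{x_1,\dots,x_d\}$ is a hyperedge, and $0$ otherwise. A coloring is a surjective map $f:[n]\to[k]$ with color matrix $P$ ($n\times k$, $p_{x,i}=1$ iff $f(x)=i$); thus $N=P^TP$ is diagonal with $i$-th diagonal entry equal to the number of vertices of color $i$. We use $$(\mathbb{A}\circ P)_{x,j_1,\dots,j_{d-1}}=\sum_{x_1,\dots,x_{d-1}}a_{x,x_1,\dots,x_{d-1}}p_{x_1,j_1}\cdots p_{x_{d-1},j_{d-1}},\qquad (P\circ\mathbb{S})_{x,\beta}=\sum_ip_{x,i}s_{i,\beta}.$$ The coloring is perfect if there is a $d$-dimensional $\mathbb{S}$ of order $k$ with $\mathbb{A}\circ P=P\circ\mathbb{S}$ (equivalently, all vertices of the same color lie in equally many hyperedges of each color range); this $\mathbb{S}$ is unique and is the parameter matrix. A $d$-dimensional matrix $\mathbb{H}$ is symmetric if $h_\alpha=h_{(\alpha_{\sigma(1)},\dots,\alpha_{\sigma(d)})}$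 for all indices $\alpha$ and all permutations $\sigma\in S_d$. *)

(* Defs.v *)
From HB Require Import structures.
From mathcomp Require Import all_boot all_order all_fingroup all_algebra.

Set Implicit Arguments.
Unset Strict Implicit.
Unset Printing Implicit Defensive.

Import GRing.Theory Num.Theory.
Local Open Scope ring_scope.

(* In array types, [d] is one less than the dimension, so that every array has a
   first index: an element of [array R d m k] is a (d+1)-dimensional array whose
   first index ranges over m values and whose d other indices range over k
   values. A (d+1)-dimensional matrix of order k is an [array R d k k]. *)
Definition array (R : Type) (d m k : nat) : Type :=
  {ffun 'I_m -> {ffun d.-tuple 'I_k -> R}}.

Definition entry (R : Type) (d k : nat) (H : array R d k k)
    (alpha : d.+1.-tuple 'I_k) : R :=
  H (thead alpha) [tuple of behead alpha].

Definition array_symmetric (R : Type) (d k : nat) (H : array R d k k) : Prop :=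
  forall (alpha : d.+1.-tuple 'I_k) (s : 'S_d.+1),
    entry H alpha = entry H [tuple tnth alpha (s i) | i < d.+1].

Definition array_mx_comp (R : pzRingType) (d m n k : nat)
    (A : array R d m n) (P : 'M[R]_(n, k)) : array R d m k :=
  [ffun x => [ffun js : d.-tuple 'I_k =>
    \sum_(xs : d.-tuple 'I_n)
      A x xs * \prod_(i < d) P (tnth xs i) (tnth js i)]].

Definition mx_array_comp (R : pzRingType) (d m n k : nat)
    (M : 'M[R]_(m, n)) (S : array R d n k) : array R d m k :=
  [ffun x => [ffun beta : d.-tuple 'I_k => \sum_i M x i * S i beta]].

Definition uniform (n r : nat) (E : {set {set 'I_n}}) : Prop :=
  forall e, e \in E -> #|e| = r.

(* For a (d+1)-uniform [E] the nonzero entries are 1/((d+1)-1)!; uniformity also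
   forces the coordinates of the index of a nonzero entry to be distinct. *)
Definition adjacency (R : numFieldType) (n d : nat) (E : {set {set 'I_n}}) :
    array R d n n :=
  [ffun x => [ffun xs : d.-tuple 'I_n =>
    if [set y in x :: xs] \in E then (d`!)%:R^-1 else 0]].

Definition coloring (n k : nat) (f : 'I_n -> 'I_k) : Prop :=
  forall i, exists x, f x = i.

Definition color_matrix (R : numFieldType) (n k : nat) (f : 'I_n -> 'I_k) :
    'M[R]_(n, k) :=
  \matrix_(x, i) (f x == i)%:R.

Definition perfect_coloring (R : numFieldType) (n d k : nat)
    (E : {set {set 'I_n}}) (f : 'I_n -> 'I_k) (S : array R d k k) : Prop :=
  coloring f /\
  array_mx_comp (adjacency R d E) (color_matrix R f)
    = mx_array_comp (color_matrix R f) S.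

(* Main.v *)
Require Import Defs.
From HB Require Import structures.
From mathcomp Require Import all_boot all_order all_fingroup all_algebra.

(** Since A o P = P o S, associativity gives N o S = P^T o (P o S) = P^T o (A o P).
    The entry of the latter at alpha is the sum over all vertex tuples y of
    a_y * prod_i p_(y_i, alpha_i); permuting alpha is absorbed by permuting the
    summation variable y, because A is symmetric. *)

Local Open Scope ring_scope.

Import GRing.Theory.

(** The body repeats the permuted index of [array_symmetric], so the two agree by unfolding. *)
Definition permute_tuple {T : Type} {m : nat} (s : 'S_m) (t : m.-tuple T) :
    m.-tuple T :=
  [tuple tnth t (s i) | i < m].

Lemma permute_tupleK (T : Type) (m : nat) (s : 'S_m) :
  cancel (@permute_tuple T m s) (permute_tuple s^-1%g).
Proof.
by move=> t; apply: eq_from_tnth => i; rewrite !tnth_map !tnth_ord_tuple permKV.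
Qed.

Lemma mem_permute_tuple (T : eqType) (m : nat) (s : 'S_m) (t : m.-tuple T) :
  permute_tuple s t =i t.
Proof.
move=> y; apply/tnthP/tnthP => -[i ->].
  by exists (s i); rewrite tnth_map tnth_ord_tuple.
by exists (s^-1%g i); rewrite tnth_map tnth_ord_tuple permKV.
Qed.

Lemma mx_array_compA (R : pzRingType) (d l m n k : nat)
    (M : 'M[R]_(l, m)) (N : 'M[R]_(m, n)) (S : array R d n k) :
  mx_array_comp (M *m N) S = mx_array_comp M (mx_array_comp N S).
Proof.
apply/ffunP => x; apply/ffunP => beta; rewrite !ffunE.
under eq_bigr => i _ do rewrite mxE mulr_suml.
rewrite exchange_big; apply: eq_bigr => j _.
rewrite !ffunE mulr_sumr; apply: eq_bigr => i _.
by rewrite mulrA.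
Qed.

Lemma sum_tuple_cons (R : nmodType) (T : finType) (d : nat)
    (F : d.+1.-tuple T -> R) :
  \sum_y F y = \sum_x \sum_(xs : d.-tuple T) F [tuple of x :: xs].
Proof.
rewrite pair_big /=.
rewrite (reindex (fun p : T * d.-tuple T => [tuple of p.1 :: p.2])) //=.
exists (fun y : d.+1.-tuple T => (thead y, [tuple of behead y])).
  by move=> [x xs] _ /=; rewrite theadE; congr pair; apply: val_inj.
by move=> y _; rewrite /= -tuple_eta.
Qed.

(** The outer sum, from [P^T], runs over the first vertex and the inner one over the other [d].
    Merging them into one sum over [d.+1]-tuples puts all indices on the same footing, so that
    permutations can act. *)
Lemma entry_congruence (R : comPzRingType) (d n k : nat) (A : array R d n n)
    (P : 'M[R]_(n, k)) (alpha : d.+1.-tuple 'I_k) :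
  entry (mx_array_comp P^T (array_mx_comp A P)) alpha =
  \sum_(y : d.+1.-tuple 'I_n)
    entry A y * \prod_(i < d.+1) P (tnth y i) (tnth alpha i).
Proof.
rewrite sum_tuple_cons /entry !ffunE; apply: eq_bigr => x _.
rewrite mxE !ffunE mulr_sumr; apply: eq_bigr => xs _.
rewrite theadE big_ord_recl tnth0 mulrCA; congr (A x _ * (_ * _)).
  exact: val_inj.
(* [tnth_behead] gives the position as [inord i.+1], while [big_ord_recl] gives [lift ord0 i]; both
   have value [i.+1], which is within bounds. *)
apply: eq_bigr => i _; rewrite tnthS tnth_behead (_ : inord _ = lift ord0 i) //.
by apply: val_inj; rewrite /= inordK // ltnS.
Qed.

Lemma congruence_symmetric (R : comPzRingType) (d n k : nat) (A : array R d n n)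
    (P : 'M[R]_(n, k)) :
  array_symmetric A ->
  array_symmetric (mx_array_comp P^T (array_mx_comp A P)).
Proof.
move=> symA alpha s; rewrite !entry_congruence.
rewrite [RHS](reindex (permute_tuple s)); last first.
  exists (permute_tuple s^-1%g) => y _; first exact: permute_tupleK.
  (* The cancellation in the other order is [permute_tupleK] at the inverse of [s]. *)
  by rewrite -{1}(invgK s) permute_tupleK.
apply: eq_bigr => y _; rewrite -symA; congr (_ * _).
(* On the right both [y] and [alpha] are now permuted by [s]; taking the factors on the left in the
   order given by [s] matches them one by one. *)
rewrite (reindex_inj (@perm_inj _ s)) /=.
by apply: eq_bigr => i _; rewrite !tnth_map !tnth_ord_tuple.
Qed.

Lemma entry_adjacency (R : numFieldType) (n d : nat) (E : {set {set 'I_n}})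
    (y : d.+1.-tuple 'I_n) :
  entry (adjacency R d E) y =
  if [set z in y] \in E then (d`!)%:R^-1 else 0.
Proof.
rewrite /entry !ffunE.
suff -> : [set z in thead y :: [tuple of behead y]] = [set z in y] by [].
by apply/setP => z; rewrite !inE [in RHS](tuple_eta y) inE.
Qed.

(** An entry depends only on the set of coordinates of its index, which no permutation changes. *)
Lemma adjacency_symmetric (R : numFieldType) (n d : nat)
    (E : {set {set 'I_n}}) :
  array_symmetric (adjacency R d E).
Proof.
move=> y s; rewrite !entry_adjacency.
suff -> : [set z in permute_tuple s y] = [set z in y] by [].
by apply/setP => z; rewrite !inE mem_permute_tuple.
Qed.

Theorem theorem6 (R : numFieldType) (n d k : nat) (E : {set {set 'I_n}})
    (f : 'I_n -> 'I_k) (S : array R d k k)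
    (hE : uniform d.+1 E)
    (hf : perfect_coloring E f S) :
  array_symmetric
    (mx_array_comp ((color_matrix R f)^T *m color_matrix R f) S).
Proof.
case: hf => _ perfS; rewrite mx_array_compA -perfS.
by apply: congruence_symmetric; apply: adjacency_symmetric.
Qed.
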